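(* Let $\mathcal{R}$ be a commutative ring, let $\mathbf{M},\mathbf{N}$ be $\mathcal{R}$-modules, and let $a,b,c,d\in\mathcal{R}$. (a) There is a natural isomorphism of $\mathcal{R}[T]$-modules $$\mathcal{F}_{\mathbf{M}}(a,b)\oplus\mathcal{F}_{\mathbf{N}}(a,b)\cong\mathcal{F}_{\mathbf{M}\oplus\mathbf{N}}(a,b).$$ (b) There is a natural isomorphism of $\mathcal{R}^2$-modules $$\mathcal{F}_{\mathbf{M}}(a,b)\oplus\mathcal{F}_{\mathbf{N}}(c,d)\cong\mathcal{F}_{\mathbf{M}\oplus\mathbf{N}}\big((a,c),(b,d)\big).$$
   Context: For a commutative ring $\mathcal{S}$, an $\mathcal{S}$-module $\mathbf{L}$ and $(a,b)\in\mathcal{S}^2$, the Fibonacci module $\mathcal{F}_{\mathbf{L}}(a,b)$ is the set of all sequences $(x_n)_{n\ge 0}$ with $x_n\in\mathbf{L}$ and $x_{n+2}=a x_{n+1}+b x_n$ for all $n\ge 0$. It is an $\mathcal{S}$-module under termwise operations and an $\mathcal{S}[T]$-module with $T$ acting by the shift $T(x_0,x_1,x_2,\ldots)=(x_1,x_2,x_3,\ldots)$. In (a) this is used with $\mathcal{S}=\mathcal{R}$. In (b), $\mathcal{R}^2$ denotes the product ring $\mathcal{R}\times\mathcal{R}$. The group $\mathbf{M}\oplus\mathbf{N}$ is an $\mathcal{R}^2$-module via $(r,s)(m,n)=(rm,sn)$, and the left-hand side is an $\mathcal{R}^2$-module in the same way (first coordinate acting on the first summand, second on the second). The right-hand side is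 the Fibonacci module over $\mathcal{S}=\mathcal{R}^2$ with recurrence $z_{n+2}=(a,c)z_{n+1}+(b,d)z_n$. ''Natural'' means natural in $\mathbf{M}$ and $\mathbf{N}$. *)

(* Defs.v *)
From HB Require Import structures.
From mathcomp Require Import all_boot all_algebra.
From mathcomp Require Import boolp functions.

Set Implicit Arguments.
Unset Strict Implicit.
Unset Printing Implicit Defensive.

Import GRing.Theory.
Local Open Scope ring_scope.

(* [{poly R}] requires [1 != 0] in [R]. To cover every commutative ring, the
   zero ring included, [R[T]] is built here as the ring of finitely supported
   sequences of coefficients under convolution; [pzpoly_of_poly] below is a ring
   isomorphism from [{poly R}] when [R] is nonzero. *)
Section PolynomialRing.
Variable R : comPzRingType.

Definition fin_supp : {pred nat -> R} :=
  fun p => `[< exists n, forall i, (n <= i)%N -> p i = 0 >].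

Record pzpoly := PzPoly { pcoef :> nat -> R; _ : pcoef \in fin_supp }.

HB.instance Definition _ := [isSub for pcoef].
HB.instance Definition _ := [Choice of pzpoly by <:].

Lemma fin_supp_zmod_closed : zmod_closed fin_supp.
Proof.
split=> [|p q /asboolP[m pm] /asboolP[n qn]]; apply/asboolP.
  by exists 0%N.
exists (maxn m n) => i; rewrite geq_max => /andP[mi ni].
by rewrite opprfctE addrfctE pm ?qn // subr0.
Qed.

HB.instance Definition _ := GRing.isZmodClosed.Build _ fin_supp
  fin_supp_zmod_closed.
HB.instance Definition _ := [SubChoice_isSubZmodule of pzpoly by <:].

Implicit Types p q r : pzpoly.

Lemma pzpolyP p q : p =1 q <-> p = q.
Proof. by split=> [eq_pq|->//]; apply: val_inj; apply/funext. Qed.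

Lemma pcoefD p q i : (p + q) i = p i + q i. Proof. by []. Qed.

Lemma pbound_subproof p : exists n, forall i, (n <= i)%N -> p i = 0.
Proof. exact/asboolP/(valP p). Qed.

Definition pbound p : nat := sval (cid (pbound_subproof p)).

Lemma pcoef_default p i : (pbound p <= i)%N -> p i = 0.
Proof. by rewrite /pbound; case: cid => n /= np /np. Qed.

Lemma pconst_subproof (c : R) :
  (fun i => if i == 0%N then c else 0) \in fin_supp.
Proof. by apply/asboolP; exists 1%N; case. Qed.

Definition pconst c : pzpoly := PzPoly (pconst_subproof c).

Lemma pvar_subproof : (fun i => (i == 1%N)%:R : R) \in fin_supp.
Proof. by apply/asboolP; exists 2; case=> [|[]]. Qed.

Definition pvar : pzpoly := PzPoly pvar_subproof.

Lemma pmul_subproof p q :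
  (fun i => \sum_(j < i.+1) p j * q (i - j)%N) \in fin_supp.
Proof.
apply/asboolP; exists (pbound p + pbound q)%N => i le_i; apply: big1 => j _.
have [lt_j|le_j] := ltnP j (pbound p); last by rewrite pcoef_default ?mul0r.
rewrite (@pcoef_default q) ?mulr0 // leq_subRL; last by rewrite -ltnS.
by apply: leq_trans le_i; rewrite leq_add2r ltnW.
Qed.

Definition pmul p q : pzpoly := PzPoly (pmul_subproof p q).

Lemma conv_rev (u v : nat -> R) i :
  \sum_(j < i.+1) u j * v (i - j)%N = \sum_(j < i.+1) u (i - j)%N * v j.
Proof.
rewrite (reindex_inj rev_ord_inj) /=.
by apply: eq_bigr => j _; rewrite (sub_ordK j).
Qed.

Lemma pmulC : commutative pmul.
Proof.
move=> p q; apply/pzpolyP => i /=; rewrite conv_rev.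
by apply: eq_bigr => j _; rewrite mulrC.
Qed.

Lemma pmulA : associative pmul.
Proof.
move=> p q r; apply/pzpolyP=> i /=; rewrite [RHS](conv_rev (pmul p q) r).
pose coef3 j k := p j * (q (i - j - k)%N * r k).
transitivity (\sum_(j < i.+1) \sum_(k < i.+1 | (k <= i - j)%N) coef3 j k).
  apply: eq_bigr => /= j _; rewrite (conv_rev q r).
  by rewrite big_distrr /= (big_ord_narrow_leq (leq_subr _ _)).
rewrite (exchange_big_dep predT) //=; apply: eq_bigr => k _.
transitivity (\sum_(j < i.+1 | (j <= i - k)%N) coef3 j k).
  apply: eq_bigl => j; rewrite -ltnS -(ltnS j) -!subSn ?leq_ord //.
  by rewrite -subn_gt0 -(subn_gt0 j) -!subnDA addnC.
rewrite (big_ord_narrow_leq (leq_subr _ _)) big_distrl /=.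
by apply: eq_bigr => j _; rewrite /coef3 -!subnDA addnC mulrA.
Qed.

Lemma pmul1 : left_id (pconst 1) pmul.
Proof.
move=> p; apply/pzpolyP => i /=; rewrite big_ord_recl subn0 mul1r.
by rewrite big1 ?addr0 // => j _; rewrite mul0r.
Qed.

Lemma pmulDl : left_distributive pmul +%R.
Proof.
move=> p q r; apply/pzpolyP=> i; rewrite pcoefD /= -big_split.
by apply: eq_bigr => j _; rewrite mulrDl.
Qed.

HB.instance Definition _ := GRing.Zmodule_isComPzRing.Build pzpoly
  pmulA pmulC pmul1 pmulDl.

Lemma pcoefM p q i : (p * q) i = \sum_(j < i.+1) p j * q (i - j)%N.
Proof. by []. Qed.

Lemma pcoef1 i : (1 : pzpoly) i = if i == 0%N then 1 else 0.
Proof. by []. Qed.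

End PolynomialRing.

Notation "R [T]" := (pzpoly R) (at level 2, format "R [T]") : type_scope.

Section PolyComparison.
Variable R : comNzRingType.

Lemma poly_to_subproof (p : {poly R}) : (fun i => p`_i) \in @fin_supp R.
Proof. by apply/asboolP; exists (size p) => i; apply: nth_default. Qed.

Definition pzpoly_of_poly (p : {poly R}) : R[T] := PzPoly (poly_to_subproof p).

Lemma pzpoly_of_poly_bij : bijective pzpoly_of_poly.
Proof.
exists (fun p : R[T] => \poly_(i < pbound p) p i) => [p|p].
  apply/polyP => i; rewrite coef_poly; case: ltnP => // le_i.
  by rewrite -[RHS]/(pzpoly_of_poly p i) pcoef_default.
apply/pzpolyP => i /=; rewrite coef_poly; case: ltnP => // le_i.
by rewrite pcoef_default.
Qed.

Lemma pzpoly_of_poly_is_zmod_morphism : zmod_morphism pzpoly_of_poly.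
Proof. by move=> p q; apply/pzpolyP => i /=; rewrite coefB. Qed.

Lemma pzpoly_of_poly_is_monoid_morphism : monoid_morphism pzpoly_of_poly.
Proof.
split=> [|p q]; apply/pzpolyP => i /=; last by rewrite coefM.
by rewrite coef1; case: eqP.
Qed.

Lemma pzpoly_of_polyX : pzpoly_of_poly 'X = pvar R.
Proof. by apply/pzpolyP => i /=; rewrite coefX. Qed.

End PolyComparison.

Section FibonacciModule.
Variables (S : comPzRingType) (L : lmodType S) (a b : S).

Definition fib_rec : {pred nat -> L} :=
  fun x => `[< forall n, x n.+2 = a *: x n.+1 + b *: x n >].

Record fib := Fib { fib_seq :> nat -> L; _ : fib_seq \in fib_rec }.

HB.instance Definition _ := [isSub for fib_seq].
HB.instance Definition _ := [Choice of fib by <:].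

Lemma fib_rec_submod_closed : submod_closed fib_rec.
Proof.
split=> [|c x y /asboolP xP /asboolP yP]; apply/asboolP => n.
  by rewrite !scaler0 addr0.
rewrite addrfctE scalrfctE xP yP !scalerDr !scalerA ![_ * c]mulrC.
by rewrite addrACA.
Qed.

HB.instance Definition _ := GRing.isSubmodClosed.Build S (nat -> L) fib_rec
  fib_rec_submod_closed.
HB.instance Definition _ := [SubChoice_isSubLmodule of fib by <:].

Implicit Types x y : fib.

Lemma fibP x n : x n.+2 = a *: x n.+1 + b *: x n.
Proof. by move: n; apply/asboolP; exact: (valP x). Qed.

Lemma fib_eqP x y : x =1 y <-> x = y.
Proof. by split=> [eq_xy|->//]; apply: val_inj; apply/funext. Qed.

Lemma fib_addE x y n : (x + y) n = x n + y n. Proof. by []. Qed.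
Lemma fib_scaleE c x n : (c *: x) n = c *: x n. Proof. by []. Qed.

Lemma shift_subproof x : (fun n => x n.+1) \in fib_rec.
Proof. by apply/asboolP => n; rewrite fibP. Qed.

Definition shift x : fib := Fib (shift_subproof x).

Lemma shift_is_linear : linear shift.
Proof. by move=> c x y; apply/fib_eqP. Qed.

HB.instance Definition _ := GRing.isLinear.Build S fib fib _ shift
  shift_is_linear.

End FibonacciModule.

Arguments shift {S L a b} x.

Section FibonacciMap.
Variables (S : comPzRingType) (L L' : lmodType S) (a b : S).

Lemma fib_map_subproof (f : {linear L -> L'}) (x : fib L a b) :
  f \o x \in @fib_rec S L' a b.
Proof. by apply/asboolP => n /=; rewrite fibP linearD !linearZ. Qed.

Definition fib_map f (x : fib L a b) : fib L' a b := Fib (fib_map_subproof f x).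

Lemma fib_map_is_linear f : linear (fib_map f).
Proof. by move=> c x y; apply/fib_eqP => n /=; rewrite linearP. Qed.

HB.instance Definition _ f := GRing.isLinear.Build S (fib L a b) (fib L' a b) _
  (fib_map f) (fib_map_is_linear f).

End FibonacciMap.

(* The type [fib L a b] already carries its [S]-module structure; its
   [S[T]]-module structure lives on this copy. *)
Definition fibT (S : comPzRingType) (L : lmodType S) (a b : S) : Type :=
  fib L a b.

Section ShiftModule.
Variables (S : comPzRingType) (L : lmodType S) (a b : S).

HB.instance Definition _ := GRing.Zmodule.copy (fibT L a b) (fib L a b).

Definition poly_act (p : S[T]) (x : fib L a b) : fib L a b :=
  \sum_(i < pbound p) p i *: iter i shift x.

Implicit Types (p q : S[T]) (x y : fib L a b).

Lemma poly_actE p x n : (forall i, (n <= i)%N -> p i = 0) ->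
  poly_act p x = \sum_(i < n) p i *: iter i shift x.
Proof.
move=> np; have widen m k : (m <= k)%N -> (forall i, (m <= i)%N -> p i = 0) ->
    \sum_(i < m) p i *: iter i shift x =
    \sum_(i < k) p i *: iter i shift x.
  move=> le_mk mp; rewrite (big_ord_widen _ (fun i => p i *: iter i _ x) le_mk).
  rewrite [RHS](bigID (fun i : 'I__ => (i < m)%N)) /=.
  rewrite [X in _ + X]big1 ?addr0 //.
  by move=> i; rewrite -leqNgt => /mp->; rewrite scale0r.
rewrite /poly_act (widen _ _ (leq_maxl _ n)); last exact: pcoef_default.
by rewrite (widen n _ (leq_maxr (pbound p) _)).
Qed.

Lemma iter_shift_sum i n (F : 'I_n -> fib L a b) :
  iter i shift (\sum_j F j) = \sum_j iter i shift (F j).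
Proof. by elim: i => //= i ->; rewrite linear_sum. Qed.

Lemma iter_shiftZ i c x :
  iter i shift (c *: x) = c *: iter i shift x.
Proof. by elim: i => //= i ->; rewrite linearZ. Qed.

Lemma iter_shiftD i x y : iter i shift (x + y) =
  iter i shift x + iter i shift y.
Proof. by elim: i => //= i ->; rewrite linearD. Qed.

Lemma poly_actA p q x : poly_act p (poly_act q x) = poly_act (p * q) x.
Proof.
set m := pbound p; set n := pbound q.
have pm i : (m <= i)%N -> p i = 0 by exact: pcoef_default.
have qn i : (n <= i)%N -> q i = 0 by exact: pcoef_default.
pose s i := iter i shift x.
have pqmn i : (m + n <= i)%N -> (p * q) i = 0.
  move=> le_i; apply: big1 => j _; have [lt_j|/pm->] := ltnP j m; last first.
    by rewrite mul0r.
  rewrite qn ?mulr0 // leq_subRL; last by rewrite -ltnS.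
  by apply: leq_trans le_i; rewrite leq_add2r ltnW.
rewrite (poly_actE _ pqmn) [LHS](@poly_actE _ _ (m + n)%N); last first.
  by move=> i le_i; apply: pm; apply: leq_trans le_i; rewrite leq_addr.
transitivity (\sum_(i < m + n) \sum_(j < m + n | (i <= j)%N)
    (p i * q (j - i)%N) *: s j); last first.
  rewrite (exchange_big_dep predT) //=; apply: eq_bigr => j _.
  rewrite scaler_suml.
  by rewrite (big_ord_widen (m + n) (fun i => (p i * q (j - i)%N) *: s j)) //.
apply: eq_bigr => i _; have [lt_i|le_i] := ltnP i m; last first.
  by rewrite pm // scale0r big1 // => j _; rewrite mul0r scale0r.
rewrite (@poly_actE q x (m + n - i)%N); last first.
  move=> j le_j; apply: qn; apply: leq_trans le_j.
  by rewrite leq_subRL 1?leq_add2r ltnW // (leq_trans lt_i) ?leq_addr.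
rewrite iter_shift_sum scaler_sumr.
rewrite -(big_mkord xpredT (fun j => p i *: iter i _ (q j *: s j))).
rewrite -(big_mkord (fun j => (i <= j)%N)
  (fun j => (p i * q (j - i)%N) *: s j)).
have le_i : (i <= m + n)%N by exact: ltnW.
rewrite (big_cat_nat (leq0n i) le_i) /=.
rewrite [X in X + _]big_nat_cond [X in X + _]big1 ?add0r; last first.
  by move=> j /andP[/andP[_ lt_ji] le_ij]; rewrite leqNgt lt_ji in le_ij.
rewrite big_mkord [RHS]big_mkcond [RHS](@big_addn _ _ _ 0 (m + n) i xpredT).
rewrite big_mkord.
apply: eq_bigr => j _; rewrite leq_addl addnK iter_shiftZ scalerA.
by rewrite /s [(j + i)%N]addnC iterD.
Qed.

Lemma poly_act1 x : poly_act 1 x = x.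
Proof.
rewrite (@poly_actE _ _ 1%N); last by case.
by rewrite big_ord1 pcoef1 scale1r.
Qed.

Lemma poly_actDr : right_distributive poly_act +%R.
Proof.
move=> p x y; rewrite /poly_act -big_split; apply: eq_bigr => i _ /=.
by rewrite iter_shiftD scalerDr.
Qed.

Lemma poly_actDl x : {morph poly_act^~ x : p q / p + q}.
Proof.
move=> p q; pose n := maxn (pbound p) (pbound q).
have pn i : (n <= i)%N -> p i = 0.
  by rewrite geq_max => /andP[/pcoef_default].
have qn i : (n <= i)%N -> q i = 0.
  by rewrite geq_max => /andP[_ /pcoef_default].
rewrite (poly_actE _ pn) (poly_actE _ qn) (@poly_actE _ _ n); last first.
  by move=> i le_i; rewrite pcoefD pn ?qn // addr0.
by rewrite -big_split; apply: eq_bigr => i _; rewrite pcoefD scalerDl.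
Qed.

HB.instance Definition _ := GRing.Zmodule_isLmodule.Build S[T] (fibT L a b)
  poly_actA poly_act1 poly_actDr poly_actDl.

Lemma fibT_scaleE p (x : fibT L a b) :
  p *: x = \sum_(i < pbound p) p i *: iter i shift x.
Proof. by []. Qed.

Lemma fibT_scaleC c (x : fibT L a b) : pconst c *: x = c *: (x : fib L a b).
Proof. by rewrite [LHS](@poly_actE _ _ 1%N) ?big_ord1 //; case. Qed.

Lemma fibT_scaleX (x : fibT L a b) : pvar S *: x = shift x.
Proof.
rewrite [LHS](@poly_actE _ _ 2%N); last by case=> [|[]].
by rewrite big_ord_recl big_ord1 /= scale0r add0r scale1r.
Qed.

End ShiftModule.

Section FibonacciMapT.
Variables (S : comPzRingType) (L L' : lmodType S) (a b : S).

Definition fibT_map (f : {linear L -> L'}) : fibT L a b -> fibT L' a b :=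
  fib_map f.

Lemma fibT_map_is_linear f : linear (fibT_map f).
Proof.
move=> p x y; rewrite /fibT_map [LHS](linearD (fib_map f)); congr (_ + _).
rewrite !fibT_scaleE linear_sum; apply: eq_bigr => i _; rewrite linearZ.
apply: (congr1 (fun z : fib L' a b => p i *: z)).
elim: (nat_of_ord i) => //= k <-; exact/fib_eqP.
Qed.

HB.instance Definition _ f := GRing.isLinear.Build S[T]
  (fibT L a b) (fibT L' a b) _ (fibT_map f) (fibT_map_is_linear f).

End FibonacciMapT.

Definition pair_map (A A' B B' : Type) (f : A -> A') (g : B -> B')
  (x : A * B) : A' * B' := (f x.1, g x.2).

Section PairMap.
Variables (R : pzRingType) (M M' N N' : lmodType R).
Variables (f : {linear M -> M'}) (g : {linear N -> N'}).

Lemma pair_map_is_linear : linear (pair_map f g).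
Proof. by move=> c x y; rewrite /pair_map /= !linearP. Qed.

HB.instance Definition _ := GRing.isLinear.Build R (M * N)%type (M' * N')%type _
  (pair_map f g) pair_map_is_linear.

End PairMap.

(* [(M * N)%type] is canonically the direct sum as an [R]-module; this copy
   carries the componentwise action of the product ring [R * R]. *)
Definition dsum2 (R : pzRingType) (M N : lmodType R) : Type := (M * N)%type.

Section ProductRingModule.
Variables (R : pzRingType) (M N : lmodType R).

HB.instance Definition _ := GRing.Zmodule.copy (dsum2 M N) (M * N)%type.

Definition dsum2_scale (r : R * R) (x : dsum2 M N) : dsum2 M N :=
  (r.1 *: x.1, r.2 *: x.2).

Lemma dsum2_scaleA r s x :
  dsum2_scale r (dsum2_scale s x) = dsum2_scale (r * s) x.
Proof. by rewrite /dsum2_scale /= !scalerA. Qed.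

Lemma dsum2_scale1 : left_id 1 dsum2_scale.
Proof. by case=> m n; rewrite /dsum2_scale /= !scale1r. Qed.

Lemma dsum2_scaleDr : right_distributive dsum2_scale +%R.
Proof. by move=> r x y; rewrite /dsum2_scale /= !scalerDr. Qed.

Lemma dsum2_scaleDl x : {morph dsum2_scale^~ x : r s / r + s}.
Proof. by move=> r s; rewrite /dsum2_scale /= !scalerDl. Qed.

HB.instance Definition _ := GRing.Zmodule_isLmodule.Build (R * R)%type
  (dsum2 M N) dsum2_scaleA dsum2_scale1 dsum2_scaleDr dsum2_scaleDl.

End ProductRingModule.

Section ProductRingMap.
Variables (R : pzRingType) (M M' N N' : lmodType R).

Definition dsum2_map (f : {linear M -> M'}) (g : {linear N -> N'}) :
  dsum2 M N -> dsum2 M' N' := pair_map f g.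

Lemma dsum2_map_is_linear f g : linear (dsum2_map f g).
Proof.
by move=> r x y; rewrite /dsum2_map /pair_map /= !linearP.
Qed.

HB.instance Definition _ f g := GRing.isLinear.Build (R * R)%type
  (dsum2 M N) (dsum2 M' N') _ (dsum2_map f g) (dsum2_map_is_linear f g).

End ProductRingMap.

(* Main.v *)
Require Import Defs.
From HB Require Import structures.
From mathcomp Require Import all_boot all_algebra.
From mathcomp Require Import boolp functions.

Set Implicit Arguments.
Unset Strict Implicit.
Unset Printing Implicit Defensive.

Import GRing.Theory.
Local Open Scope ring_scope.

(** A sequence in a direct sum is a pair of sequences, and since scalars act coordinatewise, the
    recurrence holds for the pair exactly when it holds in each coordinate. In (b) the same pairing
    works because [(a, c)] and [(b, d)] act through [a], [b] on the first coordinate and [c], [d] on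
    the second. Hence [fib_pair] and [fib_pair2] are bijective; linearity and naturality hold
    because pairing is done term by term. *)

Section DirectSum.
Variables (R : comPzRingType) (M N : lmodType R) (a b : R).

Lemma fib_pair_subproof (x : fibT M a b * fibT N a b) :
  (fun n => (fib_seq x.1 n, fib_seq x.2 n)) \in @fib_rec R (M * N)%type a b.
Proof. by apply/asboolP => n; rewrite /= !fibP. Qed.

Definition fib_pair (x : fibT M a b * fibT N a b) : fibT (M * N)%type a b :=
  Fib (fib_pair_subproof x).

(** Written with the maps induced by the projections rather than with raw sequences, so that
    linearity over [R[T]] is inherited from [fibT_map]. *)
Definition fib_unpair (z : fibT (M * N)%type a b) : fibT M a b * fibT N a b :=
  (fibT_map fst z, fibT_map snd z).

Lemma fib_pairK : cancel fib_pair fib_unpair.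
Proof. by case=> x y; congr pair; apply/fib_eqP. Qed.

Lemma fib_unpairK : cancel fib_unpair fib_pair.
Proof. by move=> z; apply/fib_eqP => n /=; case: (fib_seq z n). Qed.

Lemma fib_unpair_is_linear : linear fib_unpair.
Proof. by move=> p x y; rewrite /fib_unpair !linearP. Qed.

(* [fib_pair] is linear over [R[T]] as the inverse of a map whose two components
   are induced by the projections, so the action of [T] need not be unfolded. *)
Lemma fib_pair_is_linear : linear fib_pair.
Proof.
move=> p x y; apply: (can_inj fib_unpairK).
by rewrite fib_unpair_is_linear !fib_pairK.
Qed.

HB.instance Definition _ := GRing.isLinear.Build R[T]
  (fibT M a b * fibT N a b)%type (fibT (M * N)%type a b) _
  fib_pair fib_pair_is_linear.

Lemma fib_pair_bij : bijective fib_pair.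
Proof. by exists fib_unpair; [exact: fib_pairK | exact: fib_unpairK]. Qed.

End DirectSum.

Section ProductRing.
Variables (R : comPzRingType) (M N : lmodType R) (a b c d : R).

Lemma fib_pair2_subproof (x : dsum2 (fib M a b) (fib N c d)) :
  (fun n => (x.1 n, x.2 n)) \in @fib_rec (R * R)%type (dsum2 M N) (a, c) (b, d).
Proof. by apply/asboolP => n; rewrite !fibP. Qed.

Definition fib_pair2 (x : dsum2 (fib M a b) (fib N c d)) :
  fib (dsum2 M N) (a, c) (b, d) := Fib (fib_pair2_subproof x).

(** The action of [R * R] is termwise on both sides, so the two sequences agree at each index by
    computation. *)
Lemma fib_pair2_is_linear : linear fib_pair2.
Proof. by move=> r x y; apply/fib_eqP. Qed.

HB.instance Definition _ := GRing.isLinear.Build (R * R)%type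
  (dsum2 (fib M a b) (fib N c d)) (fib (dsum2 M N) (a, c) (b, d)) _
  fib_pair2 fib_pair2_is_linear.

Implicit Type z : fib (dsum2 M N) (a, c) (b, d).

(** [M] is a module over [R] and [dsum2 M N] over [R * R], so the projection cannot be fed to
    [fib_map]; the coordinate sequences are checked directly. *)
Lemma fib_fst2_subproof z : (fun n => (z n).1) \in @fib_rec R M a b.
Proof. by apply/asboolP => n; rewrite fibP. Qed.

Lemma fib_snd2_subproof z : (fun n => (z n).2) \in @fib_rec R N c d.
Proof. by apply/asboolP => n; rewrite fibP. Qed.

Lemma fib_pair2_bij : bijective fib_pair2.
Proof.
exists (fun z => (Fib (fib_fst2_subproof z), Fib (fib_snd2_subproof z))).
  by case=> x y; congr pair; apply/fib_eqP.
by move=> z; apply/fib_eqP => n /=; case: (z n).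
Qed.

End ProductRing.

Theorem proposition1p5 (R : comPzRingType) (a b c d : R) :
  (exists phi : forall M N : lmodType R,
      {linear (fibT M a b * fibT N a b)%type -> fibT (M * N)%type a b},
    (forall M N : lmodType R, bijective (phi M N)) /\
    (forall (M M' N N' : lmodType R)
        (f : {linear M -> M'}) (g : {linear N -> N'})
        (x : (fibT M a b * fibT N a b)%type),
      fibT_map (pair_map f g) (phi M N x) =
      phi M' N' (pair_map (fibT_map f) (fibT_map g) x))) /\
  (exists psi : forall M N : lmodType R,
      {linear dsum2 (fib M a b) (fib N c d) -> fib (dsum2 M N) (a, c) (b, d)},
    (forall M N : lmodType R, bijective (psi M N)) /\
    (forall (M M' N N' : lmodType R)
        (f : {linear M -> M'}) (g : {linear N -> N'})
        (x : dsum2 (fib M a b) (fib N c d)),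
      fib_map (dsum2_map f g) (psi M N x) =
      psi M' N' (dsum2_map (fib_map f) (fib_map g) x))).
Proof.
split.
  exists (fun M N => @fib_pair R M N a b); split=> [M N | *].
    exact: fib_pair_bij.
  (* Naturality: at each index [n] both sides compute to the pair of [f (x.1 n)] and [g (x.2 n)]. *)
  exact/fib_eqP.
exists (fun M N => @fib_pair2 R M N a b c d); split=> [M N | *].
  exact: fib_pair2_bij.
exact/fib_eqP.
Qed.
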